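(* Suppose the sensor topology graph $\mathcal{G}=(\mathcal{N},\mathcal{E})$ is undirected and generically globally rigid (Assumption 1). A profile $\boldsymbol{x}^{\Diamond}\in\boldsymbol{\Omega}$ is the (global) Nash equilibrium of the sensor network localization game $G$ if and only if there exists $\sigma^{\Diamond}\in\mathbb{E}^{+}$ such that $(\boldsymbol{x}^{\Diamond},\sigma^{\Diamond})\in\boldsymbol{\Omega}\times\mathbb{E}^{+}$ is a stationary point of $\Gamma(\boldsymbol{x},\sigma)$ satisfying $$\sigma_{ij}^{s\Diamond}=\nabla_{\xi_{ij}^s}\Psi_s(\xi^s)\big|_{\xi_{ij}^s=\|x_i^{\Diamond}-x_j^{\Diamond}\|^2}=2\left(\|x_i^{\Diamond}-x_j^{\Diamond}\|^2-d_{ij}^2\right)\quad\forall (i,j)\in\mathcal{E}_{ss},$$ $$\sigma_{il}^{a\Diamond}=\nabla_{\xi_{il}^a}\Psi_a(\xi^a)\big|_{\xi_{il}^a=\|x_i^{\Diamond}-a_l\|^2}=2\left(\|x_i^{\Diamond}-a_l\|^2-e_{il}^2\right)\quad\forall (i,l)\in\mathcal{E}_{as}.$$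
   Context: Sensor network. Let $n\in\{2,3\}$. There are $N$ non-anchor nodes $\mathcal{N}_s=\{1,\dots,N\}$ with unknown true positions $x_i^{\star}\in\mathbb{R}^n$ and $M$ anchor nodes $\mathcal{N}_a=\{N+1,\dots,N+M\}$ with known true positions $a_l=x_l^{\star}\in\mathbb{R}^n$. Set $\mathcal{N}=\mathcal{N}_s\cup\mathcal{N}_a$. With a sensing range $R_s>0$, $\mathcal{E}=\mathcal{E}_{ss}\cup\mathcal{E}_{as}\cup\mathcal{E}_{aa}$, where $\mathcal{E}_{ss}$ is the set of pairs of distinct non-anchor nodes $i,j$ with $\|x_i^{\star}-x_j^{\star}\|\le R_s$, $\mathcal{E}_{as}$ is the set of pairs $(i,l)\in\mathcal{N}_s\times\mathcal{N}_a$ with $\|x_i^{\star}-a_l\|\le R_s$, and $\mathcal{E}_{aa}$ is the set of all pairs of distinct anchors. Edges are undirected and each is counted once in sums. $\mathcal{N}_s^i=\{j:(i,j)\in\mathcal{E}_{ss}\}$ and $\mathcal{N}_a^i=\{l:(i,l)\in\mathcal{E}_{as}\}$. Measurements are noise-free: $d_{ij}=\|x_i^{\star}-x_j^{\star}\|$ for $(i,j)\in\mathcal{E}_{ss}$ and $e_{il}=\|x_i^{\star}-a_l\|$ for $(i,l)\in\mathcal{E}_{as}$. Write $\boldsymbol{x}=\operatorname{col}\{x_1,\dots,x_N\}\in\mathbb{R}^{nN}$, $\boldsymbol{x}_{-i}$ for $\boldsymbol{x}$ with $x_i$ removed, and $\boldsymbol{x}^{\star}=\operatorname{col}\{x_1^{\star},\dots,x_N^{\star}\}$.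 Game $G$. Player $i\in\mathcal{N}_s$ chooses $x_i\in\Omega_i$, where $\Omega_i\subseteq\mathbb{R}^n$ is convex and compact, to minimize $J_i(x_i,\boldsymbol{x}_{-i})=\sum_{j\in\mathcal{N}_s^i}(\|x_i-x_j\|^2-d_{ij}^2)^2+\sum_{l\in\mathcal{N}_a^i}(\|x_i-a_l\|^2-e_{il}^2)^2$; $\boldsymbol{\Omega}=\prod_{i=1}^N\Omega_i$. A (global) Nash equilibrium is $\boldsymbol{x}^{\Diamond}\in\boldsymbol{\Omega}$ with $J_i(x_i^{\Diamond},\boldsymbol{x}_{-i}^{\Diamond})\le J_i(x_i,\boldsymbol{x}_{-i}^{\Diamond})$ for all $i\in\mathcal{N}_s$, $x_i\in\Omega_i$. Rigidity. An $n$-dimensional framework is a graph with an assignment of a point of $\mathbb{R}^n$ to each node; it is generic if the set of all coordinates of its points is algebraically independent over the rationals. A framework is globally rigid if every framework on the same graph with the same edge lengths has the same distances between all pairs of nodes. A graph is generically globally rigid if every generic framework of it in $\mathbb{R}^n$ is globally rigid. Standing fact recalled by the paper: under Assumption 1, the problem of finding $x_1,\dots,x_N\in\mathbb{R}^n$ with $\|x_i-x_j\|=d_{ij}$ on $\mathcal{E}_{ss}$ and $\|x_i-a_l\|=e_{il}$ on $\mathcal{E}_{as}$ has the unique solution $\boldsymbol{x}^{\star}$. The paper also takes the Nash equilibrium of $G$ to be unique and equal to $\boldsymbol{x}^{\star}$ under Assumption 1. Dual objects. Put $\xi_{ij}^s=\|x_i-x_j\|^2$, $\xi_{il}^a=\|x_i-a_l\|^2$;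 $\xi^s=(\xi^s_{ij})_{(i,j)\in\mathcal{E}_{ss}}\in\Theta_s$ and $\xi^a=(\xi^a_{il})_{(i,l)\in\mathcal{E}_{as}}\in\Theta_a$, where $\Theta_s,\Theta_a$ are the domains in which these vectors lie. Let $\Psi_s(\xi^s)=\sum_{(i,j)\in\mathcal{E}_{ss}}(\xi_{ij}^s-d_{ij}^2)^2$ on $\Theta_s$ and $\Psi_a(\xi^a)=\sum_{(i,l)\in\mathcal{E}_{as}}(\xi_{il}^a-e_{il}^2)^2$ on $\Theta_a$, and let $\Theta_s^*,\Theta_a^*$ be the ranges of $\nabla\Psi_s,\nabla\Psi_a$; $\Theta^*=\Theta_s^*\times\Theta_a^*\subseteq\mathbb{R}^q$, $q=|\mathcal{E}_{ss}|+|\mathcal{E}_{as}|$. For $\sigma=\operatorname{col}\{\sigma^s,\sigma^a\}$ with $\sigma^s=(\sigma_{ij}^s)_{(i,j)\in\mathcal{E}_{ss}}$, $\sigma^a=(\sigma_{il}^a)_{(i,l)\in\mathcal{E}_{as}}$, the complementary function is $$\Gamma(\boldsymbol{x},\sigma)=\sum_{(i,j)\in\mathcal{E}_{ss}}\sigma_{ij}^s(\|x_i-x_j\|^2-d_{ij}^2)+\sum_{(i,l)\in\mathcal{E}_{as}}\sigma_{il}^a(\|x_i-a_l\|^2-e_{il}^2)-\sum_{(i,j)\in\mathcal{E}_{ss}}\frac{(\sigma_{ij}^s)^2}{4}-\sum_{(i,l)\in\mathcal{E}_{as}}\frac{(\sigma_{il}^a)^2}{4}.$$ Let $P(\sigma)=\nabla_{\boldsymbol{x}}^2\Gamma(\boldsymbol{x},\sigma)$,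 which does not depend on $\boldsymbol{x}$, and $\mathbb{E}^{+}=\Theta^*\cap\{\sigma:P(\sigma)\succeq 0\}$ (the paper takes this to be a nonempty convex set containing $\boldsymbol{0}_q$). Stationary point of $\Gamma$ on $\boldsymbol{\Omega}\times\mathbb{E}^{+}$: a point $(\boldsymbol{x}^{\Diamond},\sigma^{\Diamond})$ with $\boldsymbol{0}\in\nabla_{\boldsymbol{x}}\Gamma(\boldsymbol{x}^{\Diamond},\sigma^{\Diamond})+\mathcal{N}_{\boldsymbol{\Omega}}(\boldsymbol{x}^{\Diamond})$ and $\boldsymbol{0}\in-\nabla_{\sigma}\Gamma(\boldsymbol{x}^{\Diamond},\sigma^{\Diamond})+\mathcal{N}_{\mathbb{E}^{+}}(\sigma^{\Diamond})$, where $\mathcal{N}_K(\cdot)$ is the normal cone to the convex set $K$. *)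

(* Defs.v *)
From HB Require Import structures.
From mathcomp Require Import all_boot all_order all_algebra.
From mathcomp Require Import all_classical all_reals all_analysis.
From mathcomp Require Import -(notations) mpoly.

Set Implicit Arguments.
Unset Strict Implicit.
Unset Printing Implicit Defensive.

Import Order.TTheory GRing.Theory Num.Theory.
Import numFieldNormedType.Exports.

Local Open Scope classical_set_scope.
Local Open Scope ring_scope.

Section Euclidean.
Context {R : realType}.

Definition dotp m (u v : 'rV[R]_m) : R := \sum_k u 0 k * v 0 k.

(* The canonical norm [`| _ |] on ['rV[R]_m] is the sup norm, hence this one;
   the topology is the same. *)
Definition enorm m (v : 'rV[R]_m) : R := Num.sqrt (\sum_k v 0 k ^+ 2).

Definition gradient m (f : 'rV[R]_m -> R) (x : 'rV[R]_m) : 'rV[R]_m :=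
  \row_k 'D_(delta_mx 0 k) f x.

Definition hessian m (f : 'rV[R]_m -> R) (x : 'rV[R]_m) : 'M[R]_m :=
  \matrix_(k, l) 'D_(delta_mx 0 k) (fun y => 'D_(delta_mx 0 l) f y) x.

Definition psdmx m (A : 'M[R]_m) : Prop :=
  A^T = A /\ forall v : 'rV[R]_m, 0 <= (v *m A *m v^T) 0 0.

Definition normal_cone m (K : set 'rV[R]_m) (x : 'rV[R]_m) : set 'rV[R]_m :=
  [set v | K x /\ forall y, K y -> dotp v (y - x) <= 0].

End Euclidean.

Section Rigidity.
Context {R : realType} (V : finType) (n : nat).
Implicit Types (e : rel V) (p : V -> 'rV[R]_n).

Definition alg_indep_over_rat (I : finType) (c : I -> R) : Prop :=
  forall q : mpoly #|I| rat, q != 0 ->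
    mmap (ratr : rat -> R) (fun k => c (enum_val k)) q != 0.

(* Independence is that of the family of the [#|V| * n] coordinates: a value
   taken by two different coordinates already violates it. *)
Definition generic_framework p : Prop :=
  alg_indep_over_rat (fun vk : V * 'I_n => p vk.1 0 vk.2).

Definition globally_rigid e p : Prop :=
  forall q : V -> 'rV[R]_n,
    (forall u v, e u v -> enorm (q u - q v) = enorm (p u - p v)) ->
    forall u v, enorm (q u - q v) = enorm (p u - p v).

End Rigidity.

Definition generically_globally_rigid (R : realType) (n : nat) (V : finType)
    (e : rel V) : Prop :=
  forall p : V -> 'rV[R]_n, generic_framework p -> globally_rigid e p.

(* [xstar] is col{x_1^star, ..., x_N^star}, see [pos] for its blocks. *)
Record network (R : realType) (n N M : nat) := Network {
  xstar : 'rV[R]_(N * n);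
  anchor : 'I_M -> 'rV[R]_n;
  sensing_range : R }.

Section Network.
Context {R : realType} {n N M : nat}.
Variable net : network R n N M.
Implicit Types (x : 'rV[R]_(N * n)) (i j : 'I_N) (l : 'I_M).

Definition pos x i : 'rV[R]_n := row i (vec_mx x).

Definition dist_ss x i j : R := enorm (pos x i - pos x j).
Definition dist_as x i l : R := enorm (pos x i - anchor net l).

Definition near_ss i j : bool :=
  (i != j) && (dist_ss (xstar net) i j <= sensing_range net).
Definition near_as i l : bool := dist_as (xstar net) i l <= sensing_range net.

(* Nodes are ['I_N + 'I_M]: [inl] for non-anchors, [inr] for anchors. *)
Definition network_graph : rel ('I_N + 'I_M)%type := fun u v =>
  match u, v with
  | inl i, inl j => near_ss i j
  | inl i, inr l => near_as i l
  | inr l, inl i => near_as i l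
  | inr k, inr l => k != l
  end.

(* d_ij and e_il; only used on edges. *)
Definition dmeas i j : R := dist_ss (xstar net) i j.
Definition emeas i l : R := dist_as (xstar net) i l.

(* An undirected edge between non-anchors is the ordered pair with i < j. *)
Definition Ess : finType :=
  {ij : 'I_N * 'I_N | (ij.1 < ij.2)%N && near_ss ij.1 ij.2}.
Definition Eas : finType := {il : 'I_N * 'I_M | near_as il.1 il.2}.

Section Game.
Variable Omega : 'I_N -> set 'rV[R]_n.

Definition profiles : set 'rV[R]_(N * n) :=
  [set x | forall i, Omega i (pos x i)].

(* J_i(y, x_{-i}): only the blocks [pos x j] with [j != i] are used. *)
Definition cost i (y : 'rV[R]_n) x : R :=
  \sum_(j | near_ss i j) (enorm (y - pos x j) ^+ 2 - dmeas i j ^+ 2) ^+ 2 +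
  \sum_(l | near_as i l) (enorm (y - anchor net l) ^+ 2 - emeas i l ^+ 2) ^+ 2.

Definition nash_equilibria : set 'rV[R]_(N * n) :=
  [set x | profiles x /\
    forall i y, Omega i y -> cost i (pos x i) x <= cost i y x].

End Game.

(* Vectors indexed by edges are row vectors; the entry of the edge [e] has
   index [enum_rank e]. *)
Definition xi_s x : 'rV[R]_#|Ess| :=
  \row_k dist_ss x (val (enum_val k)).1 (val (enum_val k)).2 ^+ 2.
Definition xi_a x : 'rV[R]_#|Eas| :=
  \row_k dist_as x (val (enum_val k)).1 (val (enum_val k)).2 ^+ 2.

Definition Psi_s (xi : 'rV[R]_#|Ess|) : R :=
  \sum_(e : Ess) (xi 0 (enum_rank e) - dmeas (val e).1 (val e).2 ^+ 2) ^+ 2.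
Definition Psi_a (xi : 'rV[R]_#|Eas|) : R :=
  \sum_(e : Eas) (xi 0 (enum_rank e) - emeas (val e).1 (val e).2 ^+ 2) ^+ 2.

(* sigma = col{sigma^s, sigma^a} *)
Definition sigma_s (sigma : 'rV[R]_(#|Ess| + #|Eas|)) (e : Ess) : R :=
  lsubmx sigma 0 (enum_rank e).
Definition sigma_a (sigma : 'rV[R]_(#|Ess| + #|Eas|)) (e : Eas) : R :=
  rsubmx sigma 0 (enum_rank e).

Definition Gamma x (sigma : 'rV[R]_(#|Ess| + #|Eas|)) : R :=
  \sum_(e : Ess) sigma_s sigma e *
    (dist_ss x (val e).1 (val e).2 ^+ 2 - dmeas (val e).1 (val e).2 ^+ 2) +
  \sum_(e : Eas) sigma_a sigma e *
    (dist_as x (val e).1 (val e).2 ^+ 2 - emeas (val e).1 (val e).2 ^+ 2) -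
  \sum_(e : Ess) sigma_s sigma e ^+ 2 / 4 -
  \sum_(e : Eas) sigma_a sigma e ^+ 2 / 4.

Section Dual.
Variables (Theta_s : set 'rV[R]_#|Ess|) (Theta_a : set 'rV[R]_#|Eas|).

Definition dual_domain : set 'rV[R]_(#|Ess| + #|Eas|) :=
  [set sigma | (gradient Psi_s @` Theta_s) (lsubmx sigma) /\
               (gradient Psi_a @` Theta_a) (rsubmx sigma)].

(* The Hessian does not depend on [x]. *)
Definition Eplus : set 'rV[R]_(#|Ess| + #|Eas|) :=
  dual_domain `&`
  [set sigma | forall x, psdmx (hessian (fun y => Gamma y sigma) x)].

Definition stationary_point (Om : set 'rV[R]_(N * n)) x
    (sigma : 'rV[R]_(#|Ess| + #|Eas|)) : Prop :=
  [/\ Om x, Eplus sigma,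
      exists2 v, normal_cone Om x v &
        0 = gradient (fun y => Gamma y sigma) x + v
    & exists2 w, normal_cone Eplus sigma w &
        0 = - gradient (Gamma x) sigma + w].

End Dual.
End Network.

Arguments Psi_s {R n N M} net xi.
Arguments Psi_a {R n N M} net xi.
Arguments Eplus {R n N M} net Theta_s Theta_a.
Arguments stationary_point {R n N M} net Theta_s Theta_a Om x sigma.

(* Main.v *)
Require Import Defs.
From HB Require Import structures.
From mathcomp Require Import all_boot all_order all_algebra.
From mathcomp Require Import all_classical all_reals all_analysis.
From mathcomp Require Import ring lra.

Set Implicit Arguments.
Unset Strict Implicit.
Unset Printing Implicit Defensive.

Import Order.TTheory GRing.Theory Num.Theory.
Import numFieldNormedType.Exports.
Local Open Scope classical_set_scope.
Local Open Scope ring_scope.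

(** Let X be the true configuration. It is the only equilibrium, hence in
particular a feasible profile, and all edge residuals |x_i - x_j|^2 - d_ij^2
and |x_i - a_l|^2 - e_il^2 vanish at X.

An equilibrium x equals X, and sigma = 0 is the multiplier. The canonical
relation holds because the residuals vanish ([gradient_Psi_s],
[gradient_Psi_a]); 0 lies in E^+ because it is the gradient of Psi at X and
Gamma(., 0) is identically zero, so that its Hessian is the zero matrix
([Eplus0]); and both gradients of Gamma vanish at (X, 0), so that the zero
vector of each normal cone witnesses stationarity.

Conversely let (x, sigma) be stationary and canonical. Gamma(., sigma) is a
polynomial of degree at most two, hence equal to its second-order Taylor
expansion; its Hessian being positive semidefinite, the variational inequality
makes x a global minimiser of Gamma(., sigma) over the profiles
([psd_quadratic_minimizer]). Let Pi be the sum of the squared residuals over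
all edges ([potential]). Since s r - s^2 / 4 <= r^2, with equality for s = 2 r,
Gamma(y, sigma) <= Pi(y) for every y, with equality at y = x by the canonical
relation ([Gamma_le_potential], [Gamma_canonical]). Therefore
  Pi(x) = Gamma(x, sigma) <= Gamma(X, sigma) <= Pi(X) = 0,
all residuals vanish at x, and every player has cost 0, the least possible
value: x is an equilibrium. *)

(** * Quadratic functions of a row vector *)

(** The difference quotient is exactly [a + h * b], so that directional
derivatives of polynomials of degree two need no differentiation rules. *)
Lemma derive_of_quadratic_increment (R : realType) (m : nat)
    (f : 'rV[R]_m -> R) (x v : 'rV[R]_m) (a b : R) :
  (forall h : R, f (h *: v + x) = f x + h * a + h ^+ 2 * b) -> 'D_v f x = a.
Proof.
move=> fE; rewrite /derive.
apply/cvg_lim => //.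
(* The limit is the value at h = 0 of the continuous map h |-> a + h * b. *)
have -> : a = a + 0 * b by rewrite mul0r addr0.
apply: (@cvg_trans _ ((fun h : R => a + h * b) @ 0^')).
  apply: near_eq_cvg; near=> h.
  have h0 : h != 0 by near: h; exact: nbhs_dnbhs_neq.
  rewrite /= fE /GRing.scale /=; field.
  exact: h0.
apply: cvg_within_filter.
apply: cvgD; first exact: cvg_cst.
by apply: cvgM; [exact: cvg_id | exact: cvg_cst].
Unshelve. all: by end_near.
Qed.

Definition quadratic_at {R : realType} {m : nat}
    (c : R) (b : 'cV[R]_m) (A : 'M[R]_m) (x : 'rV[R]_m) : R :=
  c + (x *m b) 0 0 + (x *m A *m x^T) 0 0.

(** Degree at most two: the coefficients are existential, so that the closure
properties below never have to exhibit the Hessian of Gamma. *)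
Definition is_quadratic {R : realType} {m : nat} (f : 'rV[R]_m -> R) : Prop :=
  exists c b A, forall x, f x = quadratic_at c b A x.

Lemma quadratic_increment (R : realType) (m : nat) (c : R) (b : 'cV[R]_m)
    (A : 'M[R]_m) (x v : 'rV[R]_m) (h : R) :
  quadratic_at c b A (h *: v + x) =
  quadratic_at c b A x + h * (v *m (b + (A + A^T) *m x^T)) 0 0
  + h ^+ 2 * (v *m A *m v^T) 0 0.
Proof.
have tr11 : (x *m A *m v^T) 0 0 = (v *m A^T *m x^T) 0 0.
  by rewrite -[in RHS]mulmxA -trmx_mul -[in RHS](trmxK v) -trmx_mul [RHS]mxE.
rewrite /quadratic_at linearP /= !mulmxDl !mulmxDr -!scalemxAl -!scalemxAr.
rewrite ?mulmxDl ?mulmxDr !mulmxA.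
move: tr11; rewrite !mxE => ->; rewrite -?scalemxAl ?mxE; ring.
Qed.

Lemma derive_quadratic (R : realType) (m : nat) (c : R) (b : 'cV[R]_m)
    (A : 'M[R]_m) (x v : 'rV[R]_m) :
  'D_v (quadratic_at c b A) x = (v *m (b + (A + A^T) *m x^T)) 0 0.
Proof.
apply: (@derive_of_quadratic_increment _ _ _ _ _ _ ((v *m A *m v^T) 0 0)) => h.
exact: quadratic_increment.
Qed.

Lemma delta_mulmx (R : realType) (m : nat) (k : 'I_m) (u : 'cV[R]_m) :
  ((delta_mx 0 k : 'rV_m) *m u) 0 0 = u k 0.
Proof. by rewrite -rowE mxE. Qed.

Lemma gradient_quadratic (R : realType) (m : nat) (c : R) (b : 'cV[R]_m)
    (A : 'M[R]_m) (x : 'rV[R]_m) :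
  gradient (quadratic_at c b A) x = (b + (A + A^T) *m x^T)^T.
Proof.
by apply/rowP => k; rewrite mxE derive_quadratic delta_mulmx [RHS]mxE.
Qed.

Lemma hessian_quadratic (R : realType) (m : nat) (c : R) (b : 'cV[R]_m)
    (A : 'M[R]_m) (x : 'rV[R]_m) :
  hessian (quadratic_at c b A) x = A + A^T.
Proof.
apply/matrixP => k l; rewrite mxE.
have -> : (fun y => 'D_(delta_mx 0 l) (quadratic_at c b A) y) =
    quadratic_at (b l 0) (row l (A + A^T))^T 0.
  apply/funext => y; rewrite derive_quadratic delta_mulmx /quadratic_at.
  rewrite mulmx0 mul0mx [in X in _ = _ + X]mxE addr0 [LHS]mxE; congr (_ + _).
  by rewrite -[y in RHS]trmxK -trmx_mul [RHS]mxE -row_mul [RHS]mxE.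
rewrite derive_quadratic delta_mulmx trmx0 addr0 mul0mx addr0 !mxE.
by rewrite addrC.
Qed.

Lemma dotpE (R : realType) (m : nat) (u v : 'rV[R]_m) :
  dotp u v = (v *m u^T) 0 0.
Proof. by rewrite /dotp mxE; apply: eq_bigr => k _; rewrite mxE mulrC. Qed.

(** The expansion at [x] has no remainder, and its coefficients are those read
off from the derivatives in [gradient_quadratic] and [hessian_quadratic]. *)
Lemma quadratic_taylor2 (R : realType) (m : nat) (f : 'rV[R]_m -> R) :
  is_quadratic f -> forall x y,
  f y = f x + dotp (gradient f x) (y - x)
      + ((y - x) *m hessian f x *m (y - x)^T) 0 0 / 2.
Proof.
move=> [c [b [A fE]]] x y; have {fE} -> : f = quadratic_at c b A by exact/funext.
rewrite gradient_quadratic hessian_quadratic dotpE trmxK.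
rewrite -{1}(subrK x y) -[y - x as X in X + x]scale1r quadratic_increment.
move: (y - x) => v {y}.
have -> : (v *m (A + A^T) *m v^T) 0 0 = (v *m A *m v^T) 0 0 * 2.
  rewrite mulmxDr mulmxDl mxE mulr_natr mulr2n; congr (_ + _).
  by rewrite -[in LHS]mulmxA -trmx_mul -[in LHS](trmxK v) -trmx_mul trmxK [LHS]mxE.
by field.
Qed.

(** In the exact expansion at [x] the first-order term is nonnegative by the
variational inequality, and the second-order one by semidefiniteness. *)
Lemma psd_quadratic_minimizer (R : realType) (m : nat) (f : 'rV[R]_m -> R)
    (K : set 'rV[R]_m) (x v : 'rV[R]_m) :
  is_quadratic f -> psdmx (hessian f x) ->
  normal_cone K x v -> 0 = gradient f x + v ->
  forall y, K y -> f x <= f y.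
Proof.
move=> qf [_ psd] [_ vK] /eqP; rewrite eq_sym addr_eq0 => /eqP gE y Ky.
rewrite (quadratic_taylor2 qf x y) -addrA lerDl addr_ge0 //.
  have -> : dotp (gradient f x) (y - x) = - dotp v (y - x).
    by rewrite gE !dotpE linearN /= mulmxN mxE.
  by rewrite oppr_ge0 vK.
by rewrite divr_ge0.
Qed.

Section QuadraticClosure.
Context {R : realType} {m : nat}.
Implicit Types f g : 'rV[R]_m -> R.

Lemma is_quadratic_cst (a : R) : is_quadratic (fun _ : 'rV[R]_m => a).
Proof.
exists a, 0, 0 => x; rewrite /quadratic_at !mulmx0 mul0mx.
by rewrite [in RHS]mxE !addr0.
Qed.

Lemma is_quadraticD f g : is_quadratic f -> is_quadratic g ->
  is_quadratic (fun x => f x + g x).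
Proof.
move=> [c [b [A fE]]] [c' [b' [A' gE]]].
exists (c + c'), (b + b'), (A + A') => x; rewrite fE gE /quadratic_at.
by rewrite !mulmxDr mulmxDl ![in RHS]mxE ![in LHS]mxE; ring.
Qed.

Lemma is_quadraticZ (a : R) f : is_quadratic f ->
  is_quadratic (fun x => a * f x).
Proof.
move=> [c [b [A fE]]]; exists (a * c), (a *: b), (a *: A) => x.
rewrite fE /quadratic_at -!scalemxAr -scalemxAl ![in RHS]mxE ![in LHS]mxE.
by ring.
Qed.

Lemma is_quadratic_sum (I : Type) (r : seq I) (F : I -> 'rV[R]_m -> R) :
  (forall i, is_quadratic (F i)) -> is_quadratic (fun x => \sum_(i <- r) F i x).
Proof.
move=> qF; elim: r => [|i r IH].
  under eq_fun do rewrite big_nil; exact: is_quadratic_cst.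
under eq_fun do rewrite big_cons; exact: is_quadraticD.
Qed.

Lemma is_quadratic_sqr_affine (a : R) (b : 'cV[R]_m) :
  is_quadratic (fun x => ((x *m b) 0 0 + a) ^+ 2).
Proof.
exists (a ^+ 2), ((2 * a) *: b), (b *m b^T) => x; rewrite /quadratic_at.
(* The square of a linear form has a rank-one matrix. *)
have -> : (x *m (b *m b^T) *m x^T) 0 0 = (x *m b) 0 0 ^+ 2.
  rewrite mulmxA -mulmxA -trmx_mul [LHS]mxE big_ord1.
  by rewrite ![(_^T) _ _]mxE expr2.
by rewrite -scalemxAr [in X in _ + X + _]mxE; ring.
Qed.

End QuadraticClosure.

(** * Distances, sums of squares and trivial derivatives *)

Lemma enorm_sqr (R : realType) (m : nat) (v : 'rV[R]_m) :
  enorm v ^+ 2 = \sum_k v 0 k ^+ 2.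
Proof. by rewrite sqr_sqrtr // sumr_ge0 // => k _; rewrite sqr_ge0. Qed.

Lemma enorm_distC (R : realType) (m : nat) (u v : 'rV[R]_m) :
  enorm (u - v) = enorm (v - u).
Proof.
congr (Num.sqrt _); apply: eq_bigr => k _; rewrite -[v - u]opprB.
by rewrite [in RHS]mxE sqrrN.
Qed.

(** Common to Psi_s and Psi_a: moving the coordinate of [i] by [h] changes the
single summand of index [i]. *)
Lemma gradient_sum_sqr (R : realType) (I : finType) (d : I -> R)
    (xi : 'rV[R]_#|I|) (i : I) :
  gradient (fun eta => \sum_j (eta 0 (enum_rank j) - d j) ^+ 2) xi 0 (enum_rank i)
  = 2 * (xi 0 (enum_rank i) - d i).
Proof.
rewrite mxE; apply: (@derive_of_quadratic_increment _ _ _ _ _ _ 1) => h.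
rewrite (bigD1 i) //= [in RHS](bigD1 i) //=.
have -> : \sum_(j | j != i)
    ((h *: delta_mx 0 (enum_rank i) + xi) 0 (enum_rank j) - d j) ^+ 2 =
    \sum_(j | j != i) (xi 0 (enum_rank j) - d j) ^+ 2.
  apply: eq_bigr => j ji.
  by rewrite !mxE (inj_eq enum_rank_inj) (negbTE ji) mulr0 add0r.
by rewrite !mxE !eqxx /=; ring.
Qed.

Lemma hessian_cst0 (R : realType) m (x : 'rV[R]_m) :
  hessian (cst 0 : 'rV[R]_m -> R) x = 0.
Proof.
apply/matrixP => k l; rewrite !mxE.
have -> : (fun y => 'D_(delta_mx 0 l) (cst 0 : 'rV[R]_m -> R) y) = cst 0.
  by apply/funext => y; rewrite derive_cst.
by rewrite derive_cst.
Qed.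

Lemma gradient_cst0 (R : realType) m (x : 'rV[R]_m) :
  gradient (cst 0 : 'rV[R]_m -> R) x = 0.
Proof. by apply/rowP => k; rewrite !mxE derive_cst. Qed.

Lemma normal_cone0 (R : realType) m (K : set 'rV[R]_m) (x : 'rV[R]_m) :
  K x -> normal_cone K x 0.
Proof.
by move=> Kx; split=> // y _; rewrite /dotp big1 // => k _; rewrite mxE mul0r.
Qed.

(** * The complementary function *)

Section Duality.
Context {R : realType} {n N M : nat} (net : network R n N M).
Implicit Types (x y : 'rV[R]_(N * n)).
Implicit Types (sigma : 'rV[R]_(#|Ess net| + #|Eas net|)).

Definition residual_s x (e : Ess net) : R :=
  dist_ss x (val e).1 (val e).2 ^+ 2 - dmeas net (val e).1 (val e).2 ^+ 2.

Definition residual_a x (e : Eas net) : R :=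
  dist_as net x (val e).1 (val e).2 ^+ 2 - emeas net (val e).1 (val e).2 ^+ 2.

(** This is Psi_s(xi_s) + Psi_a(xi_a), seen as a function of the positions. *)
Definition potential x : R :=
  \sum_e residual_s x e ^+ 2 + \sum_e residual_a x e ^+ 2.

Lemma pos_mulmx x i k :
  pos x i 0 k = (x *m (delta_mx 0 (mxvec_index i k) : 'rV_(N * n))^T) 0 0.
Proof. by rewrite trmx_delta -colE !mxE. Qed.

(** A squared distance is a sum of squares of affine forms in the coordinates
of the whole profile. *)
Lemma is_quadratic_dist_ss i j : is_quadratic (fun x => dist_ss x i j ^+ 2).
Proof.
under eq_fun do rewrite enorm_sqr.
apply: is_quadratic_sum => k.
pose b : 'cV[R]_(N * n) := (delta_mx 0 (mxvec_index i k) : 'rV_(N * n))^T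
                         - (delta_mx 0 (mxvec_index j k) : 'rV_(N * n))^T.
suff bE x : (pos x i - pos x j) 0 k = (x *m b) 0 0 + 0.
  by under eq_fun do rewrite bE; exact: is_quadratic_sqr_affine.
have subE m (u v : 'rV[R]_m) c : (u - v) 0 c = u 0 c - v 0 c by rewrite !mxE.
by rewrite addr0 mulmxBr !subE !pos_mulmx.
Qed.

Lemma is_quadratic_dist_as i l : is_quadratic (fun x => dist_as net x i l ^+ 2).
Proof.
under eq_fun do rewrite enorm_sqr.
apply: is_quadratic_sum => k.
have aE x : (pos x i - anchor net l) 0 k =
    (x *m (delta_mx 0 (mxvec_index i k) : 'rV_(N * n))^T) 0 0 - anchor net l 0 k.
  by rewrite -pos_mulmx !mxE.
under eq_fun do rewrite aE.
exact: is_quadratic_sqr_affine.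
Qed.

Lemma is_quadratic_Gamma sigma : is_quadratic (fun x => Gamma x sigma).
Proof.
rewrite /Gamma.
do 2![apply: is_quadraticD; last exact: is_quadratic_cst].
apply: is_quadraticD; apply: is_quadratic_sum => e; apply: is_quadraticZ;
  apply: is_quadraticD; try exact: is_quadratic_cst.
  exact: is_quadratic_dist_ss.
exact: is_quadratic_dist_as.
Qed.

Lemma gradient_Psi_s x (e : Ess net) :
  gradient (Psi_s net) (xi_s net x) 0 (enum_rank e) = 2 * residual_s x e.
Proof. by rewrite gradient_sum_sqr mxE enum_rankK. Qed.

Lemma gradient_Psi_a x (e : Eas net) :
  gradient (Psi_a net) (xi_a net x) 0 (enum_rank e) = 2 * residual_a x e.
Proof. by rewrite gradient_sum_sqr mxE enum_rankK. Qed.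

(** Edge by edge, Gamma is s r - s^2 / 4 in the multiplier s and the residual
r; everything about the dual variable follows from this form. *)
Lemma Gamma_sum x sigma : Gamma x sigma =
  \sum_(e : Ess net) (sigma_s sigma e * residual_s x e - sigma_s sigma e ^+ 2 / 4)
  + \sum_(e : Eas net) (sigma_a sigma e * residual_a x e - sigma_a sigma e ^+ 2 / 4).
Proof. by rewrite /Gamma !sumrB; ring. Qed.

(** Weak duality: r^2 - (s r - s^2 / 4) = (r - s / 2)^2. *)
Lemma Gamma_le_potential x sigma : Gamma x sigma <= potential x.
Proof.
have young (s r : R) : s * r - s ^+ 2 / 4 <= r ^+ 2.
  by have := sqr_ge0 (r - s / 2); nra.
by rewrite Gamma_sum lerD // ler_sum.
Qed.

(** The multiplier s = 2 r closes the gap in [Gamma_le_potential]. *)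
Lemma Gamma_canonical x sigma :
  (forall e, sigma_s sigma e = 2 * residual_s x e) ->
  (forall e, sigma_a sigma e = 2 * residual_a x e) ->
  Gamma x sigma = potential x.
Proof.
move=> sE aE; rewrite Gamma_sum; congr (_ + _); apply: eq_bigr => e _.
  by rewrite sE; field.
by rewrite aE; field.
Qed.

Lemma potential_xstar : potential (xstar net) = 0.
Proof.
by rewrite /potential !big1 ?addr0 // => e _;
  rewrite /residual_s /residual_a subrr expr0n.
Qed.

Lemma potential_le0_residual x : potential x <= 0 ->
  (forall e, residual_s x e = 0) /\ (forall e, residual_a x e = 0).
Proof.
have s0 (I : finType) (F : I -> R) : 0 <= \sum_i F i ^+ 2.
  by rewrite sumr_ge0 // => i _; rewrite sqr_ge0.
have z0 (I : finType) (F : I -> R) : \sum_i F i ^+ 2 = 0 -> forall i, F i = 0.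
  move=> F0 i; apply/eqP; rewrite -sqrf_eq0; apply/eqP.
  by apply: (psumr_eq0P _ F0) => // j _; rewrite sqr_ge0.
move=> p0; have := s0 _ (residual_s x); have := s0 _ (residual_a x).
move: p0; rewrite /potential => p0 a0 b0.
by split; apply: z0; lra.
Qed.

(** The cost of player [i] runs over all its neighbours, whereas an edge is
stored once, as its increasing pair: for a neighbour [j < i] the edge to use is
[(j, i)], which exists because distances are symmetric. *)
Lemma residual0_cost x i :
  (forall e, residual_s x e = 0) -> (forall e, residual_a x e = 0) ->
  cost net i (pos x i) x = 0.
Proof.
move=> rs ra; rewrite /cost !big1 ?addr0 // => [l il|j ij].
  by have := ra (exist _ (i, l) il); rewrite /residual_a /= => ->; rewrite expr0n.
suff : dist_ss x i j ^+ 2 - dmeas net i j ^+ 2 = 0 by move=> ->; rewrite expr0n.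
have /andP[neq_ij dij] := ij.
case: (ltngtP i j) => [lt_ij|lt_ji|/val_inj eq_ij]; last by rewrite eq_ij eqxx in neq_ij.
  have eP : ((i, j).1 < (i, j).2)%N && near_ss net (i, j).1 (i, j).2.
    by rewrite lt_ij.
  exact: (rs (exist _ (i, j) eP)).
have eP : ((j, i).1 < (j, i).2)%N && near_ss net (j, i).1 (j, i).2.
  by rewrite lt_ji /near_ss eq_sym neq_ij /dist_ss enorm_distC.
have := rs (exist _ (j, i) eP).
by rewrite /residual_s /dmeas /dist_ss /= enorm_distC
  [X in _ - X ^+ 2 = _]enorm_distC.
Qed.

Lemma cost_ge0 i (y : 'rV[R]_n) x : 0 <= cost net i y x.
Proof. by rewrite addr_ge0 // sumr_ge0 // => k _; rewrite sqr_ge0. Qed.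

Lemma residual_s_xstar e : residual_s (xstar net) e = 0.
Proof. exact: subrr. Qed.

Lemma residual_a_xstar e : residual_a (xstar net) e = 0.
Proof. exact: subrr. Qed.

Lemma gradient_Psi_s_xstar : gradient (Psi_s net) (xi_s net (xstar net)) = 0.
Proof.
apply/rowP => k; rewrite -[k]enum_valK gradient_Psi_s residual_s_xstar mulr0.
by rewrite mxE.
Qed.

Lemma gradient_Psi_a_xstar : gradient (Psi_a net) (xi_a net (xstar net)) = 0.
Proof.
apply/rowP => k; rewrite -[k]enum_valK gradient_Psi_a residual_a_xstar mulr0.
by rewrite mxE.
Qed.

Lemma Gamma_dual0 :
  (fun x => Gamma x (0 : 'rV[R]_(#|Ess net| + #|Eas net|))) = cst 0.
Proof.
apply/funext => x; rewrite Gamma_sum /sigma_s /sigma_a !linear0.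
by rewrite !big1 ?addr0 // => e _; rewrite mxE; ring.
Qed.

(** With vanishing residuals only the terms - s^2 / 4 remain, and they have no
first-order part at 0. *)
Lemma gradient_Gamma_dual_xstar :
  gradient (Gamma (xstar net)) (0 : 'rV[R]_(#|Ess net| + #|Eas net|)) = 0.
Proof.
apply/rowP => k; rewrite !mxE.
pose s : R := \sum_(e : Ess net) sigma_s (delta_mx 0 k) e ^+ 2 / 4.
pose a : R := \sum_(e : Eas net) sigma_a (delta_mx 0 k) e ^+ 2 / 4.
apply: (@derive_of_quadratic_increment _ _ _ _ _ _ (- s - a)) => h.
rewrite addr0 (congr1 (@^~ (xstar net)) Gamma_dual0) /= Gamma_sum.
rewrite mulr0 addr0 add0r mulrDr !mulrN /s /a !mulr_sumr -!sumrN.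
congr (_ + _); apply: eq_bigr => e _.
  by rewrite residual_s_xstar /sigma_s !mxE; field.
by rewrite residual_a_xstar /sigma_a !mxE; field.
Qed.

Lemma Eplus0 (Theta_s : set 'rV[R]_#|Ess net|) (Theta_a : set 'rV[R]_#|Eas net|) :
  Theta_s (xi_s net (xstar net)) -> Theta_a (xi_a net (xstar net)) ->
  Eplus net Theta_s Theta_a 0.
Proof.
move=> Ts Ta; split.
  split; rewrite linear0.
    by exists (xi_s net (xstar net)); rewrite ?gradient_Psi_s_xstar.
  by exists (xi_a net (xstar net)); rewrite ?gradient_Psi_a_xstar.
move=> x; rewrite Gamma_dual0 hessian_cst0; split; first exact: trmx0.
by move=> v; rewrite mulmx0 mul0mx mxE.
Qed.

End Duality.

Theorem theorem1 (R : realType) (n N M : nat) (hn : n = 2%N \/ n = 3%N)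
  (net : network R n N M) (hRs : 0 < sensing_range net)
  (Omega : 'I_N -> set 'rV[R]_n)
  (Omega_convex : forall i, convex_set (Omega i))
  (Omega_compact : forall i, compact (Omega i))
  (Theta_s : set 'rV[R]_#|Ess net|) (Theta_a : set 'rV[R]_#|Eas net|)
  (xi_s_Theta : forall x, profiles Omega x -> Theta_s (xi_s net x))
  (xi_a_Theta : forall x, profiles Omega x -> Theta_a (xi_a net x))
  (Eplus_convex : convex_set (Eplus net Theta_s Theta_a))
  (graph_undirected : symmetric (network_graph net))
  (graph_rigid : generically_globally_rigid R n (network_graph net))
  (nash_unique : symmetric (network_graph net) ->
    generically_globally_rigid R n (network_graph net) ->
    nash_equilibria net Omega = [set xstar net])
  (x : 'rV[R]_(N * n)) (hx : profiles Omega x) :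
  nash_equilibria net Omega x <->
  exists2 sigma : 'rV[R]_(#|Ess net| + #|Eas net|), Eplus net Theta_s Theta_a sigma &
    [/\ stationary_point net Theta_s Theta_a (profiles Omega) x sigma,
        forall e : Ess net,
          sigma_s sigma e = gradient (Psi_s net) (xi_s net x) 0 (enum_rank e) /\
          gradient (Psi_s net) (xi_s net x) 0 (enum_rank e) =
            2 * (dist_ss x (val e).1 (val e).2 ^+ 2
                 - dmeas net (val e).1 (val e).2 ^+ 2)
      & forall e : Eas net,
          sigma_a sigma e = gradient (Psi_a net) (xi_a net x) 0 (enum_rank e) /\
          gradient (Psi_a net) (xi_a net x) 0 (enum_rank e) =
            2 * (dist_as net x (val e).1 (val e).2 ^+ 2
                 - emeas net (val e).1 (val e).2 ^+ 2)].
Proof.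
have nashE := nash_unique graph_undirected graph_rigid.
have Oxs : profiles Omega (xstar net).
  by have [] : nash_equilibria net Omega (xstar net) by rewrite nashE.
split.
(* An equilibrium is xstar, with multiplier 0. *)
- rewrite nashE => ->.
  have E0 := Eplus0 (xi_s_Theta _ Oxs) (xi_a_Theta _ Oxs).
  exists 0 => //; split.
  + split=> //.
      exists 0; first exact: normal_cone0.
      by rewrite Gamma_dual0 gradient_cst0 addr0.
    exists 0; first exact: normal_cone0.
    by rewrite gradient_Gamma_dual_xstar oppr0 addr0.
  + move=> e; split; last exact: gradient_Psi_s.
    by rewrite gradient_Psi_s residual_s_xstar mulr0 /sigma_s linear0 mxE.
  + move=> e; split; last exact: gradient_Psi_a.
    by rewrite gradient_Psi_a residual_a_xstar mulr0 /sigma_a linear0 mxE.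
(* A stationary point has potential at most that of xstar, that is 0. *)
- move=> [sigma [_ psd] [[_ _ [v vx gE] _] sE aE]].
  have GE : Gamma x sigma = potential net x.
    apply: Gamma_canonical => e.
      by have [-> ->] := sE e.
    by have [-> ->] := aE e.
  have [rs ra] : (forall e, residual_s (net := net) x e = 0) /\
      (forall e, residual_a (net := net) x e = 0).
    apply: potential_le0_residual; rewrite -GE -(potential_xstar net).
    apply: le_trans (Gamma_le_potential (xstar net) sigma).
    exact: (psd_quadratic_minimizer (is_quadratic_Gamma sigma) (psd x) vx gE).
  split=> // i y _; rewrite residual0_cost //; exact: cost_ge0.
Qed.
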